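(* Let $|q|<1$ and let $\epsilon\in\{+1,-1\}$. Define integers $e_n,f_n$ (depending on $\epsilon$) by $$\sum_{n=0}^{\infty}e_nq^n=(-\epsilon q,-\epsilon q^4;q^5)_\infty(\epsilon q^4,\epsilon q^6;q^{10})_\infty^3,\qquad \sum_{n=0}^{\infty}f_nq^n=(-\epsilon q^2,-\epsilon q^3;q^5)_\infty(\epsilon q^2,\epsilon q^8;q^{10})_\infty^3.$$ Then $e_{5n+3}=0$ and $f_{5n+4}=0$ for all $n\ge 0$.
   Context: For complex $a$ and $|q|<1$, $(a;q)_\infty=\prod_{k=0}^{\infty}(1-aq^k)$ and $(a_1,\dots,a_m;q)_\infty=(a_1;q)_\infty\cdots(a_m;q)_\infty$. (The case $\epsilon=+1$ corresponds to $(-q,-q^4;q^5)_\infty(q^4,q^6;q^{10})_\infty^3$ etc., and $\epsilon=-1$ to $(q,q^4;q^5)_\infty(-q^4,-q^6;q^{10})_\infty^3$ etc.) *)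

(* Defs.v *)
From mathcomp Require Export all_boot all_order all_algebra.
From mathcomp Require Export complex.
From mathcomp Require Export all_classical all_reals all_analysis.

Set Implicit Arguments.
Unset Strict Implicit.
Unset Printing Implicit Defensive.

Export Order.TTheory GRing.Theory Num.Theory.
Export numFieldNormedType.Exports.

Local Open Scope classical_set_scope.
Local Open Scope ring_scope.

(* The limits below are stated over an arbitrary numFieldType because R[i] has
   no canonical topology of its own; instantiated at R[i] they use the topology
   of the complex modulus. *)

(* (a; q)_oo *)
Definition qpoch (K : numFieldType) (a q : K) : K :=
  limn (fun n : nat => \prod_(0 <= k < n) (1 - a * q ^+ k)).

(* (a_1, ..., a_m; q)_oo *)
Definition qpochs (K : numFieldType) (s : seq K) (q : K) : K :=
  \prod_(a <- s) qpoch a q.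

(* sum_n c_n q^n = F q on the open unit disc; convergence of the series is part
   of the predicate *)
Definition unit_disc_expansion (K : numFieldType) (c : nat -> int)
    (F : K -> K) : Prop :=
  forall q : K, `|q| < 1 ->
    series (fun n : nat => (c n)%:~R * q ^+ n) @ \oo --> F q.

(* Main.v *)
Require Import Defs.
From mathcomp Require Import zify ring lra.
Set Implicit Arguments.
Unset Strict Implicit.
Unset Printing Implicit Defensive.
Local Open Scope ring_scope.

(* Multiplying the two products by (q^5; q^5)_oo (q^10; q^10)_oo^3, a series in
   q^5, does not affect which residue classes of coefficients modulo 5 vanish.
   By the Jacobi triple product, the result is a sum over (m, x, y, z) in Z^4 of
   eps^m (- eps)^(x + y + z) q^Q, with Q = (5m^2 + 3m)/2 + (5x^2 + x) + (5y^2 + y)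
   + (5z^2 + z) in the first case and Q = (5m^2 - m)/2 + (5x^2 + 3x) + (5y^2 + 3y)
   + (5z^2 + 3z) in the second. In both cases the residue class of the theorem is
   the one where x + y + z - m = 3 + 5k for an integer k, and there the involution
     (m, x, y, z) |-> (-m-3-4k, -x+1+2k, -y+1+2k, -z+1+2k)
   preserves Q and reverses the sign, so all the terms cancel.

   All of this takes place in polynomials modulo X^n: at real points q near 0 the
   analytic functions agree with their truncated products up to O(q^n), which
   determines the coefficients below n. *)

(** * Gaussian binomial coefficients and the q-binomial theorem *)

Section QBinomial.
Variables (A : comNzRingType) (q : A).

Definition qfact (m : nat) : A := \prod_(k < m) (1 - q ^+ k.+1).

(** Given by a q-Pascal rule, since quotients of [qfact] need not make sense in a commutative
    ring. *)
Fixpoint qbinom (m j : nat) : A :=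
  match m, j with
  | _, 0 => 1
  | 0, _.+1 => 0
  | m'.+1, j'.+1 => qbinom m' j'.+1 + q ^+ (m' - j') * qbinom m' j'
  end.

Lemma qbinom0 m : qbinom m 0 = 1.
Proof. by case: m. Qed.

Lemma qbinom_small m j : (m < j)%N -> qbinom m j = 0.
Proof.
elim: m j => [|m IH] [|j] //= lt_mj.
by rewrite !IH ?mulr0 ?addr0 // ltnW.
Qed.

Lemma qfactS m : qfact m.+1 = qfact m * (1 - q ^+ m.+1).
Proof. by rewrite /qfact big_ord_recr. Qed.

(** Induction from 1 - q^(m+1) = (1 - q^(m-j)) + q^(m-j) (1 - q^(j+1)). *)
Lemma qbinom_qfact m j : (j <= m)%N ->
  qbinom m j * (qfact j * qfact (m - j)) = qfact m.
Proof.
elim: m j => [|m IH] [|j] //= le_jm.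
- by rewrite /qfact !big_ord0 !mul1r.
- by rewrite subn0 mul1r [qfact 0]/qfact big_ord0 mul1r.
rewrite subSS; have := IH _ le_jm.
move: le_jm; rewrite ltnS leq_eqVlt => /predU1P[-> IHj|lt_jm IHj].
  by rewrite qbinom_small // subnn expr0 mul1r add0r qfactS -[in RHS]IHj subnn; ring.
have := IH _ lt_jm; rewrite !qfactS.
have E : (m - j = (m - j.+1).+1)%N by lia.
have -> : q ^+ m.+1 = q ^+ (m - j) * q ^+ j.+1.
  by rewrite -exprD; congr (_ ^+ _); lia.
move: IHj; rewrite E !qfactS -E => IHj IHj1.
transitivity (qbinom m j.+1 * (qfact j * (1 - q ^+ j.+1) * qfact (m - j.+1))
   * (1 - q ^+ (m - j)) +
   q ^+ (m - j) * (1 - q ^+ j.+1) *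
   (qbinom m j * (qfact j * (qfact (m - j.+1) * (1 - q ^+ (m - j)))))).
  by ring.
by rewrite IHj IHj1; ring.
Qed.

(** The variable [y] makes the identity homogeneous; a large power of X put for it later takes the
    place of negative powers of X. *)
Lemma qbinomial_theorem (y z : A) m :
  \prod_(k < m) (y + z * q ^+ k) =
  \sum_(j < m.+1) q ^+ 'C(j, 2) * qbinom m j * z ^+ j * y ^+ (m - j).
Proof.
elim: m => [|m IH]; first by rewrite big_ord0 big_ord1 /= !expr0 !mulr1.
rewrite big_ord_recr /= {}IH mulrDr [RHS]big_ord_recl /=.
transitivity (y ^+ m.+1 + (\sum_(j < m) q ^+ 'C(j.+1, 2) * qbinom m j.+1 *
    z ^+ j.+1 * y ^+ (m - j) +
    \sum_(j < m.+1) q ^+ 'C(j, 2) * q ^+ m * qbinom m j * z ^+ j.+1 * y ^+ (m - j))).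
  rewrite addrA; congr (_ + _).
    rewrite mulr_suml big_ord_recl /= subn0 qbinom0 bin0n !expr0 !mul1r -exprSr.
    congr (_ + _); apply: eq_bigr => j _.
    rewrite /bump /= add1n -mulrA -exprSr.
    by congr (_ * _ ^+ _); have := ltn_ord j; lia.
  rewrite mulr_suml; apply: eq_bigr => j _; rewrite exprSr; ring.
rewrite subn0 bin0n !expr0 !mul1r; congr (_ + _).
transitivity (\sum_(j < m.+1) q ^+ 'C(j.+1, 2) * qbinom m j.+1 *
    z ^+ j.+1 * y ^+ (m - j) +
    \sum_(j < m.+1) q ^+ 'C(j, 2) * q ^+ m * qbinom m j * z ^+ j.+1 * y ^+ (m - j)).
  by rewrite [in RHS]big_ord_recr /= qbinom_small // mulr0 !mul0r addr0.
rewrite -big_split; apply: eq_bigr => j _ /=; rewrite /bump /= add0n !add1n subSS.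
have -> : q ^+ 'C(j, 2) * q ^+ m = q ^+ 'C(j.+1, 2) * q ^+ (m - j).
  rewrite -!exprD binS bin1; congr (_ ^+ _); have := ltn_ord j; lia.
by ring.
Qed.

End QBinomial.

(** * Finite form of the Jacobi triple product *)

Lemma bin2D m n : 'C(m + n, 2) = ('C(m, 2) + 'C(n, 2) + m * n)%N.
Proof.
elim: n => [|n IH]; first by rewrite addn0 bin0n muln0 !addn0.
by rewrite addnS !binS !bin1 IH; lia.
Qed.

Section FiniteTripleProduct.
Variables (F : fieldType) (c : {poly F}) (a b : nat).
Hypothesis c2 : c * c = 1.
Let M := (a + b)%N.

(** Truncation of (-c X^a, -c X^b; X^(a+b))_oo; the third product of Jacobi's identity enters
    separately as [qfact]. *)
Definition triple_prod (n : nat) : {poly F} :=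
  \prod_(k < n) (1 + c * 'X^((a + b) * k + a))
  * \prod_(k < n) (1 + c * 'X^((a + b) * k + b)).

Lemma prod_monomials n :
  \prod_(k < n) (c * 'X^(M * k + a)) = c ^+ n * 'X^(M * 'C(n, 2) + a * n).
Proof.
elim: n => [|n IH].
  by rewrite big_ord0 bin0n !muln0 mul1r.
rewrite big_ord_recr /= IH mulrACA -exprSr -exprD binS bin1.
by congr (_ * _ ^+ _); ring.
Qed.

Lemma expr_signD i n : c ^+ (n + i + i) = c ^+ n.
Proof. by rewrite -addnA addnn -mul2n exprD exprM expr2 c2 expr1n mulr1. Qed.

(** The q-binomial theorem with base X^M, y = X^(M n), z = c X^a and 2 n factors. Its summation
    index n + i gives Jacobi's term at m = i, and n - (i + 1) the one at m = -(i + 1); c may replace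
    its inverse there. *)
Lemma finite_triple_product n :
  triple_prod n =
  \sum_(i < n.+1) qbinom 'X^M (n + n) (n + i)
     * (c ^+ i * 'X^(M * 'C(i, 2) + a * i))
  + \sum_(i < n) qbinom 'X^M (n + n) (n - i.+1)
     * (c ^+ i.+1 * 'X^(M * 'C(i.+1, 2) + b * i.+1)).
Proof.
(* The monomial extracted below: X^(M n) from each of the last n factors, and c X^(M k + a) from
   each of the first n, whose order is then reversed. *)
have Dnz : 'X^(M * n * n) * (c ^+ n * 'X^(M * 'C(n, 2) + a * n)) != 0.
  have cnz : c != 0.
    by apply: contra_eq_neq c2 => ->; rewrite mul0r eq_sym oner_neq0.
  by rewrite !mulf_neq0 ?expf_neq0 ?polyX_eq0.
apply: (mulfI Dnz).
have := @qbinomial_theorem _ 'X^M 'X^(M * n) (c * 'X^a) (n + n).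
rewrite big_split_ord /= -addnS big_split_ord /= => E.
transitivity (\prod_(i < n) ('X^(M * n) + c * 'X^a * 'X^M ^+ i) *
     \prod_(i < n) ('X^(M * n) + c * 'X^a * 'X^M ^+ (n + i))).
  have -> : \prod_(i < n) ('X^(M * n) + c * 'X^a * 'X^M ^+ i) =
      c ^+ n * 'X^(M * 'C(n, 2) + a * n)
      * \prod_(k < n) (1 + c * 'X^((a + b) * k + b)).
    rewrite -prod_monomials [X in _ = _ * X](reindex_inj rev_ord_inj) -big_split.
    apply: eq_bigr => k _ /=; rewrite mulrDr mulr1 addrC; congr (_ + _).
      by rewrite -mulrA -exprM -exprD addnC.
    rewrite mulrACA c2 mul1r -exprD; congr (_ ^+ _).
    rewrite -/M {1}(_ : n = k.+1 + (n - k.+1))%N; last by have := ltn_ord k; lia.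
    by rewrite /M; ring.
  have -> : \prod_(i < n) ('X^(M * n) + c * 'X^a * 'X^M ^+ (n + i)) =
      'X^(M * n * n) * \prod_(k < n) (1 + c * 'X^((a + b) * k + a)).
    have -> : 'X^(M * n * n) = \prod_(k < n) 'X^(M * n) :> {poly F}.
      by rewrite prodr_const card_ord exprM.
    rewrite -big_split.
    apply: eq_bigr => k _ /=; rewrite mulrDr mulr1; congr (_ + _).
    rewrite -mulrA [RHS]mulrCA -exprM -!exprD; congr (_ * _ ^+ _).
    by rewrite /M; ring.
  by rewrite /triple_prod; ring.
rewrite {}E mulrDr addrC; congr (_ + _); rewrite mulr_sumr.
  apply: eq_bigr => i _; have := ltn_ord i; rewrite ltnS => lt_in.
  rewrite exprMn -!exprM.
  have -> : (n + n - (n + i) = n - i)%N by lia.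
  set B := qbinom _ _ _.
  have -> : 'X^(M * 'C(n + i, 2)) * B * (c ^+ (n + i) * 'X^(a * (n + i)))
       * 'X^(M * n * (n - i)) = B * c ^+ (n + i) *
      ('X^(M * 'C(n + i, 2)) * 'X^(a * (n + i)) * 'X^(M * n * (n - i))) :> {poly F}.
    by ring.
  have -> : 'X^(M * n * n) * (c ^+ n * 'X^(M * 'C(n, 2) + a * n)) *
     (B * (c ^+ i * 'X^(M * 'C(i, 2) + a * i))) =
     B * (c ^+ n * c ^+ i) * ('X^(M * n * n) * 'X^(M * 'C(n, 2) + a * n)
       * 'X^(M * 'C(i, 2) + a * i)).
    by ring.
  rewrite -!exprD; congr (_ * _ * _ ^+ _); rewrite bin2D.
  move: (nat_of_ord i) lt_in => k le_kn.
  by rewrite -(subnK le_kn); set d := (n - k)%N; rewrite addnK; ring.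
rewrite (reindex_inj rev_ord_inj); apply: eq_bigr => i _ /=.
have lt_in := ltn_ord i; rewrite exprMn -!exprM.
have -> : (n + n - (n - i.+1) = n + i.+1)%N by lia.
set B := qbinom _ _ _.
set m := (n - i.+1)%N; have En : n = (m + i.+1)%N by lia.
have -> : 'X^(M * 'C(m, 2)) * B * (c ^+ m * 'X^(a * m))
       * 'X^(M * n * (n + i.+1)) = B * c ^+ m *
      ('X^(M * 'C(m, 2)) * 'X^(a * m) * 'X^(M * n * (n + i.+1))) :> {poly F}.
  by ring.
have -> : 'X^(M * n * n) * (c ^+ n * 'X^(M * 'C(n, 2) + a * n)) *
     (B * (c ^+ i.+1 * 'X^(M * 'C(i.+1, 2) + b * i.+1))) =
     B * (c ^+ n * c ^+ i.+1) * ('X^(M * n * n) * 'X^(M * 'C(n, 2) + a * n)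
       * 'X^(M * 'C(i.+1, 2) + b * i.+1)).
  by ring.
(* Here n + (i + 1) = m + 2 (i + 1), and even powers of c are 1. *)
rewrite -!exprD [c ^+ (n + _)](_ : _ = c ^+ m); last first.
  by rewrite -(expr_signD i.+1 m) -En.
congr (_ * _ * _ ^+ _).
move: (nat_of_ord i) m En => k m {lt_in B} ->.
have E2 : (k.+1 * k.+1 = 'C(k.+1, 2) + 'C(k.+1, 2) + k.+1)%N.
  by elim: (k.+1) => // j; rewrite !binS !bin1; lia.
rewrite bin2D; move: k.+1 E2 => j E2.
(* [ring] treats binomials as atoms, so one of the two j^2 is isolated to be rewritten as 2 C(j, 2)
   + j. *)
transitivity ((a + b) * ('C(m, 2) + m * m + 3 * (m * j) + j * j + j * j)
   + a * m)%N; first by rewrite /M; ring.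
by rewrite {2}E2 /M; ring.
Qed.

End FiniteTripleProduct.

(** * Congruence of polynomials modulo X^n *)

Section EqModX.
Variable F : fieldType.
Implicit Types (p r : {poly F}) (n : nat).

Definition eqmodX n p r : bool := 'X^n %| p - r.

Lemma eqmodXxx n p : eqmodX n p p.
Proof. by rewrite /eqmodX subrr dvdp0. Qed.

Lemma eqmodX_sym n p r : eqmodX n p r -> eqmodX n r p.
Proof. by rewrite /eqmodX -dvdpNr opprB. Qed.

Lemma eqmodX_trans n p r t : eqmodX n p r -> eqmodX n r t -> eqmodX n p t.
Proof.
by rewrite /eqmodX => h1 h2; have := dvdp_add h1 h2; rewrite addrA subrK.
Qed.

Lemma eqmodXD n p r p' r' :
  eqmodX n p r -> eqmodX n p' r' -> eqmodX n (p + p') (r + r').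
Proof. by rewrite /eqmodX opprD addrACA; apply: dvdp_add. Qed.

Lemma eqmodXM n p r p' r' :
  eqmodX n p r -> eqmodX n p' r' -> eqmodX n (p * p') (r * r').
Proof.
rewrite /eqmodX => h1 h2.
have -> : p * p' - r * r' = (p - r) * p' + r * (p' - r') by ring.
by apply: dvdp_add; [apply: dvdp_mulr | apply: dvdp_mull].
Qed.

Lemma eqmodXX n p r k : eqmodX n p r -> eqmodX n (p ^+ k) (r ^+ k).
Proof.
move=> h; elim: k => [|k IH]; first exact: eqmodXxx.
by rewrite !exprS eqmodXM.
Qed.

Lemma eqmodX_sum n (I : Type) (s : seq I) (f g : I -> {poly F}) :
  (forall i, eqmodX n (f i) (g i)) ->
  eqmodX n (\sum_(i <- s) f i) (\sum_(i <- s) g i).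
Proof.
move=> h; elim: s => [|i s IH]; first by rewrite !big_nil eqmodXxx.
by rewrite !big_cons eqmodXD.
Qed.

Lemma eqmodX_coef n p r i : eqmodX n p r -> (i < n)%N -> p`_i = r`_i.
Proof.
move=> /dvdpP[t /eqP]; rewrite subr_eq => /eqP -> lt_in.
by rewrite coefD coefMXn lt_in add0r.
Qed.

Lemma coprimep_Xn n p : p`_0 = 1 -> coprimep 'X^n p.
Proof.
move=> p0; apply: coprimep_expl; rewrite coprimep_sym coprimepX.
by rewrite /root horner_coef0 p0 oner_eq0.
Qed.

Variable M : nat.
Hypothesis M_gt0 : (0 < M)%N.

Lemma qfactX_coef0 m : (qfact ('X^M : {poly F}) m)`_0 = 1.
Proof.
rewrite -horner_coef0 /qfact horner_prod big1 // => k _.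
by rewrite -exprM !hornerE expr0n muln_eq0 eqn0Ngt M_gt0 subr0.
Qed.

Lemma qfactX_eqmodX l m : (l <= m)%N ->
  eqmodX (M * l.+1) (qfact 'X^M m) (qfact 'X^M l).
Proof.
elim: m => [|m IH]; first by rewrite leqn0 => /eqP ->; apply: eqmodXxx.
rewrite leq_eqVlt => /predU1P[->|]; first exact: eqmodXxx.
rewrite ltnS => le_lm; apply: eqmodX_trans (IH le_lm).
rewrite qfactS -[X in eqmodX _ _ X]mulr1; apply: eqmodXM; first exact: eqmodXxx.
by rewrite /eqmodX addrC addKr dvdpNr -exprM dvdp_exp2l // leq_mul2l ltnS le_lm orbT.
Qed.

(** Multiplied by u_j u_(2n-j), where u is [qfact], the left side becomes u_n u_(2n). All four
    indices are at least d, so each u is congruent to u_d; the multiplier has constant term 1 and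
    can be cancelled. *)
Lemma qbinomX_eqmodX n d j : (d <= j)%N -> (j + d <= n + n)%N -> (d <= n)%N ->
  eqmodX (M * d.+1) (qfact 'X^M n * qbinom 'X^M (n + n) j) 1.
Proof.
move=> le_dj le_jd le_dn; rewrite /eqmodX.
set u := qfact _; set B := qbinom _ _ _.
have : eqmodX (M * d.+1) (u j * u (n + n - j)%N * (u n * B)) (u j * u (n + n - j)%N).
  have -> : u j * u (n + n - j)%N * (u n * B) = u n * (B * (u j * u (n + n - j)%N)).
    by ring.
  rewrite qbinom_qfact; last by lia.
  apply: (@eqmodX_trans _ _ (u d * u d)).
    by apply: eqmodXM; apply: qfactX_eqmodX; lia.
  by apply: eqmodX_sym; apply: eqmodXM; apply: qfactX_eqmodX; lia.
rewrite /eqmodX -{2}[u j * _]mulr1 -mulrBr Gauss_dvdpr //.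
by apply: coprimep_Xn; rewrite coef0M !qfactX_coef0 mulr1.
Qed.

End EqModX.

(** * The Jacobi triple product modulo X^n *)

Definition int_box (n : nat) : seq int :=
  map Posz (iota 0 n.+1) ++ map Negz (iota 0 n).

Lemma mem_int_box n (m : int) : (m \in int_box n) = (`|m| <= n)%N.
Proof.
rewrite mem_cat; case: m => j.
  rewrite mem_map ?mem_iota; last by move=> x y [].
  rewrite (_ : _ \in map Negz _ = false) ?orbF; first by rewrite add0n ltnS.
  by apply/mapP => -[].
rewrite orbC mem_map ?mem_iota; last by move=> x y [].
rewrite (_ : _ \in map Posz _ = false) ?orbF ?add0n //.
by apply/mapP => -[].
Qed.

Lemma int_box_uniq n : uniq (int_box n).
Proof.
rewrite cat_uniq !map_inj_uniq ?iota_uniq ?andbT; try by move=> x y [].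
by rewrite andTb; apply/hasPn => x /mapP[j _ ->]; apply/mapP => -[].
Qed.

(* The exponent (a + b) m (m - 1) / 2 + a m, written without division. *)
Definition theta_exp (a b : nat) (m : int) : nat :=
  match m with
  | Posz j => (a + b) * 'C(j, 2) + a * j
  | Negz j => (a + b) * 'C(j.+1, 2) + b * j.+1
  end.

Lemma theta_expE a b (m : int) :
  2 * (theta_exp a b m)%:Z = (a + b)%:Z * m * (m - 1) + 2 * a%:Z * m.
Proof.
have E2 k : 2 * ('C(k, 2))%:Z = k%:Z * (k%:Z - 1).
  by elim: k => // k; rewrite binS bin1; nia.
case: m => j /=; rewrite ?NegzE !PoszD !PoszM mulrDr mulrCA E2; first by ring.
by rewrite PoszD; ring.
Qed.

Section TruncatedTripleProduct.
Variables (F : fieldType) (c : {poly F}) (a b : nat).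
Hypotheses (c2 : c * c = 1) (ab_gt0 : (0 < a + b)%N).

(** With M = a + b, the factor of the term of index i is 1 only modulo X^(M (n - i + 1)), but the
    term carries X^(M C(i, 2)), and i <= C(i, 2) + 1 brings the total order up to n. *)
Lemma truncated_triple_product n :
  eqmodX n (qfact 'X^(a + b) n * triple_prod c a b n)
    (\sum_(m <- int_box n) c ^+ `|m|%N * 'X^(theta_exp a b m)).
Proof.
have key i j e : (i <= n)%N -> (j == n + i)%N || (j == n - i)%N ->
    eqmodX n (qfact 'X^(a + b) n *
       (qbinom 'X^(a + b) (n + n) j * (c ^+ i * 'X^((a + b) * 'C(i, 2) + e))))
       (c ^+ i * 'X^((a + b) * 'C(i, 2) + e)).
  move=> le_in ej; have := @qbinomX_eqmodX F _ ab_gt0 n (n - i) j.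
  move=> /(_ _ _ _)/wrap[]; [lia|lia|lia|].
  rewrite /eqmodX => h; rewrite mulrA -{2}[c ^+ i * _]mul1r -mulrBl.
  rewrite mulrCA dvdp_mull // ['X^(_ * _ + e)]exprD mulrA dvdp_mulr //.
  apply: (@dvdp_trans _ ('X^((a + b) * (n - i).+1) * 'X^((a + b) * 'C(i, 2)))).
    rewrite -exprD dvdp_exp2l //.
    have : (i <= 'C(i, 2) + 1)%N.
      by case: i {le_in ej h} => // -[|[|i]] //; rewrite binS bin1; lia.
    by nia.
  exact: dvdp_mul.
(* The two halves of [int_box] index the two sums, in this order. *)
rewrite finite_triple_product // mulrDr /int_box big_cat !big_map.
have -> : iota 0 n.+1 = index_iota 0 n.+1 by rewrite /index_iota subn0.
have -> : iota 0 n = index_iota 0 n by rewrite /index_iota subn0.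
rewrite !big_mkord !mulr_sumr; apply: eqmodXD.
  apply: eqmodX_sum => i /=; apply: key; rewrite ?eqxx // -ltnS.
  exact: ltn_ord.
apply: eqmodX_sum => i /=; apply: key; rewrite ?eqxx ?orbT //.
Qed.

End TruncatedTripleProduct.

(** * Sign-reversing involutions and sums of monomials *)

Lemma sum_sign_reversing (T : eqType) (V : realDomainType) (S : seq T)
    (f : T -> T) (w : T -> V) :
  uniq S -> {in S, forall u, f u \in S} -> {in S, forall u, f (f u) = u} ->
  {in S, forall u, w (f u) = - w u} -> \sum_(u <- S) w u = 0.
Proof.
move=> uS fS fK wf.
have pS : perm_eq (map f S) S.
  apply: uniq_perm => //.
    by rewrite map_inj_in_uniq // => u v /fK {2}<- /fK {2}<- ->.
  move=> u; apply/mapP/idP => [[v vS ->]|uS']; first exact: fS.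
  by exists (f u); [exact: fS | rewrite fK].
(* In an ordered domain a sum equal to its opposite is 0, whether or not [f] has fixed points. *)
have : \sum_(u <- S) w u = - \sum_(u <- S) w u.
  rewrite -{1}(perm_big _ pS) big_map -sumrN.
  by rewrite big_seq [RHS]big_seq; apply: eq_bigr.
by lra.
Qed.

Section MonomialSums.
Variable F : fieldType.

(** Equal exponents are not collected: a product is then a sum over pairs, and a coefficient a sum
    over a level set of [e]. *)
Definition monomial_sum (T : Type) (S : seq T) (w : T -> F) (e : T -> nat) :=
  \sum_(u <- S) w u *: 'X^(e u).

Lemma monomial_sumM (T T' : Type) (S : seq T) (S' : seq T') w w' e e' :
  monomial_sum S w e * monomial_sum S' w' e' =
  monomial_sum [seq (u, v) | u <- S, v <- S']
    (fun p => w p.1 * w' p.2) (fun p => e p.1 + e' p.2)%N.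
Proof.
rewrite /monomial_sum big_allpairs mulr_suml; apply: eq_bigr => u _.
rewrite mulr_sumr; apply: eq_bigr => v _ /=.
by rewrite -scalerAl -scalerAr scalerA exprD.
Qed.

Lemma coef_monomial_sum (T : Type) (S : seq T) w e N :
  (monomial_sum S w e)`_N = \sum_(u <- S | e u == N) w u.
Proof.
rewrite coef_sum [RHS]big_mkcond; apply: eq_bigr => u _.
by rewrite coefZ coefXn eq_sym; case: eqP => _; rewrite ?mulr1 ?mulr0.
Qed.

End MonomialSums.

Lemma mem_pairs (T T' : eqType) (S : seq T) (S' : seq T') p :
  (p \in [seq (u, v) | u <- S, v <- S']) = (p.1 \in S) && (p.2 \in S').
Proof.
apply/allpairsP/andP => [[q [q1 q2 ->]]|[p1 p2]]; first by [].
by exists p; rewrite -surjective_pairing.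
Qed.

Lemma pairs_uniq (T T' : eqType) (S : seq T) (S' : seq T') :
  uniq S -> uniq S' -> uniq [seq (u, v) | u <- S, v <- S'].
Proof. by move=> uS uS'; apply: allpairs_uniq => // -[x y] [x' y']. Qed.

(** * The involution on quadruples of integers *)

Definition quad : Type := (int * (int * (int * int)))%type.

(* Completing the squares turns the exponent Q into the quadratic form
   m^2 + 2 (x^2 + y^2 + z^2); [flip] is minus its reflection in (-2, 1, 1, 1). *)
Definition flip (u : quad) : quad :=
  let: (m, (x, (y, z))) := u in
  let k := ((x + y + z - m - 3) %/ 5)%Z in
  (- m - 3 - 4 * k, (- x + 1 + 2 * k, (- y + 1 + 2 * k, - z + 1 + 2 * k))).

Definition quad_exp (a b a' b' : nat) (u : quad) : nat :=
  let: (m, (x, (y, z))) := u in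
  (theta_exp a b m + (theta_exp a' b' x + (theta_exp a' b' y + theta_exp a' b' z)))%N.

Definition quad_sign (F : fieldType) (s : F) (u : quad) : F :=
  let: (m, (x, (y, z))) := u in
  s ^+ `|m|%N * ((- s) ^+ `|x|%N * ((- s) ^+ `|y|%N * (- s) ^+ `|z|%N)).

(** The class on which the division by 5 in [flip] is exact, with quotient k. *)
Definition on_flip_class (u : quad) : Prop :=
  let: (m, (x, (y, z))) := u in exists k : int, m = x + y + z - 3 - 5 * k.

Lemma flipE m x y z k : m = x + y + z - 3 - 5 * k ->
  flip (m, (x, (y, z))) =
  (- m - 3 - 4 * k, (- x + 1 + 2 * k, (- y + 1 + 2 * k, - z + 1 + 2 * k))).
Proof. by move=> Em; rewrite /flip; have -> : ((x + y + z - m - 3) %/ 5)%Z = k by lia. Qed.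

(** [flip] leaves x + y + z - m - 3 = 5 k unchanged, so both applications use the same k. *)
Lemma flipK u : on_flip_class u -> flip (flip u) = u.
Proof.
case: u => m [x [y z]] [k Em]; rewrite (flipE Em) (@flipE _ _ _ _ k); last by lia.
by congr (_, (_, (_, _))); lia.
Qed.

(** All four coordinates change parity. The sign is (-1)^(x + y + z) for s = 1 and (-1)^m for s =
    -1, which involves an odd number of them either way. *)
Lemma flip_sign (F : fieldType) (s : F) u : s = 1 \/ s = -1 ->
  on_flip_class u -> quad_sign s (flip u) = - quad_sign s u.
Proof.
case: u => m [x [y z]] Es [k Em]; rewrite (flipE Em) /=.
case: Es => ->.
  rewrite !expr1n !mul1r -!exprD -signr_odd -[in RHS]signr_odd -signrN.
  by congr (_ ^+ _); lia.
rewrite opprK !expr1n !mulr1 -signr_odd -[in RHS]signr_odd -signrN.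
by congr (_ ^+ _); lia.
Qed.

(** As [a] varies, the centre of the quadratic form moves along (-2, 1, 1, 1), a direction fixed by
    minus the reflection; hence the same [flip] serves every [a]. *)
Lemma flip_exp a b u : (a + b = 5)%N -> on_flip_class u ->
  quad_exp a b (b + 5) a (flip u) = quad_exp a b (b + 5) a u.
Proof.
case: u => m [x [y z]] ab [k Em]; rewrite (flipE Em) /=; apply/eqP.
rewrite -eqz_nat -(inj_eq (mulfI (_ : 2%:Z != 0))) // !PoszD !mulrDr !theta_expE.
have -> : (b + 5 + a = 10)%N by lia.
rewrite ab !PoszD (_ : b%:Z = 5 - a%:Z); last by lia.
by apply/eqP; rewrite Em; ring.
Qed.

(* [a = 4] is the case of e and [a = 2] that of f. *)
Lemma quad_exp_mod5 a b u : (a + b = 5)%N -> (0 < a)%N -> (0 < b)%N ->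
  quad_exp a b (b + 5) a u = 2 * a %[mod 5] -> on_flip_class u.
Proof.
case: u => m [x [y z]] /= ab a0 b0 E; exists ((x + y + z - m - 3) %/ 5)%Z.
have := theta_expE a b m; have := theta_expE (b + 5) a x.
have := theta_expE (b + 5) a y; have := theta_expE (b + 5) a z.
(* Modulo 5 the exponent is a (m - x - y - z), with a invertible. Abstracting the quadratic terms
   and fixing a leaves a linear problem. *)
rewrite -!mulrA; move: (m * (m - 1)) (x * (x - 1)) (y * (y - 1)) (z * (z - 1)).
have [Ea|[Ea|[Ea|Ea]]] : (a = 1 \/ a = 2 \/ a = 3 \/ a = 4)%N by lia.
all: by have Eb : b = (5 - a)%N by [lia]; move: E; rewrite {}Eb {}Ea; lia.
Qed.

(** Ensures that every term of exponent below n is indexed inside [int_box n]. *)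
Lemma le_theta_exp a b m : (0 < a)%N -> (0 < b)%N -> (`|m| <= theta_exp a b m)%N.
Proof. by case: m => j /=; nia. Qed.

(** * Vanishing coefficients of the truncated products *)

Section VanishingCoefficients.
Variables (F : realFieldType) (s : F) (a b : nat).
Hypotheses (s1 : s = 1 \/ s = -1) (ab : (a + b = 5)%N).
Hypotheses (a_gt0 : (0 < a)%N) (b_gt0 : (0 < b)%N).

Lemma theta_product_coef n N : (N < n)%N -> N = 2 * a %[mod 5] ->
  ((\sum_(m <- int_box n) s%:P ^+ `|m|%N * 'X^(theta_exp a b m))
   * (\sum_(m <- int_box n) (- s)%:P ^+ `|m|%N * 'X^(theta_exp (b + 5) a m)) ^+ 3)`_N
  = 0.
Proof.
move=> lt_Nn N5.
have thetaE c a' b' :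
    \sum_(m <- int_box n) c%:P ^+ `|m|%N * 'X^(theta_exp a' b' m) =
    monomial_sum (int_box n) (fun m => c ^+ `|m|%N) (theta_exp a' b') :> {poly F}.
  by apply: eq_bigr => m _; rewrite -polyC_exp mul_polyC.
rewrite !{}thetaE !exprS expr0 mulr1 !monomial_sumM coef_monomial_sum -big_filter.
set S := [seq u <- _ | _].
(* Since N < n, the box contains every quadruple of exponent N. Thus S is a full level set, stable
   under [flip] even though the box need not be. *)
have memS u : (u \in S) = (quad_exp a b (b + 5) a u == N).
  case: u => m [x [y z]]; rewrite mem_filter !mem_pairs /= !mem_int_box.
  apply: andb_idr => /eqP E.
  have := @le_theta_exp a b m a_gt0 b_gt0.
  have b5 : (0 < b + 5)%N by lia.
  have := @le_theta_exp (b + 5) a x b5 a_gt0.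
  have := @le_theta_exp (b + 5) a y b5 a_gt0.
  have := @le_theta_exp (b + 5) a z b5 a_gt0.
  by lia.
have clS u : u \in S -> on_flip_class u.
  by rewrite memS => /eqP E; apply: (@quad_exp_mod5 a b) => //; rewrite E.
rewrite (_ : \sum_(i <- S) _ = \sum_(u <- S) quad_sign s u); last first.
  by apply: eq_bigr => -[m [x [y z]]] _ /=.
apply: (@sum_sign_reversing _ _ _ flip).
- by rewrite filter_uniq // !pairs_uniq // int_box_uniq.
- by move=> u uS; rewrite memS flip_exp // -?memS //; apply: clS.
- by move=> u /clS; apply: flipK.
- by move=> u /clS; apply: flip_sign.
Qed.

Lemma comp_qfactX M r n :
  qfact ('X^M : {poly F}) n \Po r = qfact (r ^+ M) n.
Proof.
rewrite /qfact rmorph_prod; apply: eq_bigr => k _ /=.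
by rewrite rmorphB rmorph1 !rmorphXn /= comp_polyX.
Qed.

(** The multiplier T is a polynomial in X^5 with constant term 1, so the coefficient of T P at N is
    that of P plus multiples of earlier ones in the same class modulo 5; strong induction removes
    these. *)
Lemma prod_coef_eq0 n N : (N < n)%N -> N = 2 * a %[mod 5] ->
  (triple_prod s%:P a b n * triple_prod (- s)%:P (b + 5) a n ^+ 3)`_N = 0.
Proof.
set P := _ * _.
set T : {poly F} := qfact 'X^5 n * qfact 'X^10 n ^+ 3.
have T0 : T`_0 = 1.
  rewrite /T -horner_coef0 hornerM horner_exp !horner_coef0 !qfactX_coef0 //.
  by rewrite expr1n mulr1.
have T5 i : ~~ (5 %| i)%N -> T`_i = 0.
  have -> : T = (qfact 'X^1 n * qfact 'X^2 n ^+ 3) \Po 'X^5.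
    by rewrite rmorphM rmorphXn /= !comp_qfactX expr1 -exprM.
  by rewrite coef_comp_poly_Xn // => /negbTE ->.
have TP k : (k < n)%N -> k = 2 * a %[mod 5] -> (T * P)`_k = 0.
  move=> lt_kn k5; rewrite -[RHS](theta_product_coef lt_kn k5).
  apply: (eqmodX_coef _ lt_kn).
  have -> : T * P = (qfact 'X^5 n * triple_prod s%:P a b n)
      * (qfact 'X^10 n * triple_prod (- s)%:P (b + 5) a n) ^+ 3.
    by rewrite /T /P; ring.
  have s2 : s%:P * s%:P = 1 :> {poly F}.
    by rewrite -polyCM; case: s1 => ->; rewrite ?mulrNN mulr1.
  apply: eqmodXM.
    by have := @truncated_triple_product _ _ a b s2; rewrite ab; apply.
  apply: eqmodXX.
  have := @truncated_triple_product _ (- s)%:P (b + 5) a.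
  by rewrite (_ : b + 5 + a = 10)%N; [apply; rewrite // polyCN mulrNN | lia].
elim/ltn_ind: N => N IH lt_Nn N5.
have := TP _ lt_Nn N5; rewrite coefM big_ord_recl /= T0 mul1r subn0 big1 ?addr0 //.
move=> i _; rewrite /bump /= add1n; have := ltn_ord i => lt_iN.
have [d5|nd5] := boolP (5 %| i.+1)%N; last by rewrite T5 ?mul0r.
by rewrite IH ?mulr0 //; lia.
Qed.

End VanishingCoefficients.

(** * Polynomial approximation at small positive reals *)

Section Approximation.
Local Open Scope classical_set_scope.
Variable R : realType.
Implicit Types (f g : R -> R) (p r d : {poly R}) (n : nat).

(** f = p + O(x^n) to the right of 0. The bound 1/4 keeps 2 x below the ratio 1/2 allowed in the
    geometric estimates. *)
Definition approx n f p := exists C : R,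
  forall x, 0 < x -> x <= 4^-1 -> `|f x - p.[x]| <= C * x ^+ n.

Lemma horner_bounded p : exists2 C : R, 0 <= C &
  forall x, 0 < x -> x <= 4^-1 -> `|p.[x]| <= C.
Proof.
elim/poly_ind: p => [|p c [C C0 hC]].
  by exists 0 => // x _ _; rewrite horner0 normr0.
exists (C + `|c|) => [|x x0 x4]; first by rewrite addr_ge0.
rewrite !hornerE; apply: le_trans (ler_normD _ _) _.
rewrite lerD2r normrM (gtr0_norm x0); have := hC x x0 x4.
by have := normr_ge0 p.[x]; nra.
Qed.

Lemma approxM n f g p r :
  approx n f p -> approx n g r -> approx n (fun x => f x * g x) (p * r).
Proof.
move=> [C hC] [D hD].
have [P P0 hP] := horner_bounded p; have [Q Q0 hQ] := horner_bounded r.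
exists (`|C| * (Q + `|D|) + P * `|D|) => x x0 x4.
have xn0 : 0 <= x ^+ n by rewrite exprn_ge0 // ltW.
have xn1 : x ^+ n <= 1 by rewrite exprn_ile1 ?ltW //; lra.
have le1 : `|f x - p.[x]| <= `|C| * x ^+ n.
  by apply: le_trans (hC x x0 x4) _; rewrite ler_wpM2r // ler_norm.
have le2 : `|g x - r.[x]| <= `|D| * x ^+ n.
  by apply: le_trans (hD x x0 x4) _; rewrite ler_wpM2r // ler_norm.
have le3 : `|g x| <= Q + `|D|.
  rewrite -[g x](subrK r.[x]) addrC; apply: le_trans (ler_normD _ _) _.
  by rewrite lerD ?hQ //; apply: le_trans le2 _; rewrite ler_piMr.
have -> : f x * g x - (p * r).[x] = (f x - p.[x]) * g x + p.[x] * (g x - r.[x]).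
  by rewrite hornerM; ring.
apply: le_trans (ler_normD _ _) _; rewrite !normrM mulrDl lerD //.
  by rewrite mulrAC ler_pM.
by rewrite -mulrA ler_pM // hP.
Qed.

Lemma approxX n f p k : approx n f p -> approx n (fun x => f x ^+ k) (p ^+ k).
Proof.
move=> h; elim: k => [|k IH].
  by exists 0 => x _ _; rewrite !expr0 hornerC subrr normr0 mul0r.
rewrite exprS; have := approxM h IH.
by case=> C hC; exists C => x x0 x4; rewrite exprS; apply: hC.
Qed.

(** The constant term is O(x), hence 0; dividing by x then lowers n by one. *)
Lemma small_horner_coef d n i (C : R) :
  (forall x, 0 < x -> x <= 4^-1 -> `|d.[x]| <= C * x ^+ n) ->
  (i < n)%N -> d`_i = 0.
Proof.
elim/poly_ind: d n i C => [|d c IH] n i C hC; first by rewrite coef0.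
case: n hC => [//|n] hC lt_in.
have c0 : c = 0.
  have [D D0 hD] := horner_bounded d.
  have leD x : 0 < x -> x <= 4^-1 -> `|c| <= (`|C| + D) * x.
    move=> x0 x4; have := hC x x0 x4; have := hD x x0 x4; rewrite !hornerE => h1 h2.
    have -> : c = (d.[x] * x + c) - d.[x] * x by ring.
    apply: le_trans (ler_normB _ _) _; rewrite mulrDl lerD //; last first.
      by rewrite normrM (gtr0_norm x0) ler_wpM2r // ltW.
    have xn0 : 0 <= x ^+ n by rewrite exprn_ge0 // ltW.
    have xn1 : x ^+ n <= 1 by rewrite exprn_ile1 ?ltW //; lra.
    apply: le_trans h2 _; rewrite exprS; apply: (@le_trans _ _ (`|C| * (x * x ^+ n))).
      by rewrite ler_wpM2r ?ler_norm // mulr_ge0 // ltW.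
    by rewrite ler_wpM2l // ler_piMr // ltW.
  apply/eqP; rewrite -normr_le0 leNgt; apply/negP => c_gt0.
  have B0 : 0 < `|C| + D + `|c| + 1.
    by have := normr_ge0 C; have := normr_ge0 c; lra.
  (* Makes (|C| + D) x less than |c|, against [leD]; the |c| in the denominator gives x <= 1/4. *)
  pose x := `|c| / (4 * (`|C| + D + `|c| + 1)).
  have x0 : 0 < x by rewrite divr_gt0 // mulr_gt0.
  have Ex : x * (4 * (`|C| + D + `|c| + 1)) = `|c|.
    by rewrite divfK // mulf_neq0 // ?pnatr_eq0 // gt_eqF.
  have x4 : x <= 4^-1.
    rewrite ler_pdivrMr ?mulr_gt0 // mulrA mulVf ?pnatr_eq0 // mul1r.
    by have := normr_ge0 C; lra.
  by have := leD x x0 x4; have := normr_ge0 C; nra.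
case: i lt_in => [|i] lt_in; first by rewrite coefD coefMX coefC /= add0r.
rewrite coefD coefMX coefC /= addr0; apply: (IH n i C) => // x x0 x4.
have := hC x x0 x4; rewrite !hornerE c0 addr0 normrM (gtr0_norm x0).
by rewrite exprSr mulrA ler_pM2r.
Qed.

Lemma approx_coef n f p r i : approx n f p -> approx n f r -> (i < n)%N ->
  p`_i = r`_i.
Proof.
move=> [C hC] [D hD] lt_in; apply/eqP; rewrite -subr_eq0 -coefB; apply/eqP.
apply: (@small_horner_coef _ n _ (C + D)) lt_in => x x0 x4.
have -> : (p - r).[x] = (f x - r.[x]) - (f x - p.[x]) by rewrite !hornerE; ring.
by apply: le_trans (ler_normB _ _) _; rewrite addrC mulrDl lerD ?hC ?hD.
Qed.

Lemma geometric_steps (u : R^nat) (E q : R) : 0 <= q -> q <= 2^-1 ->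
  (forall m, `|u m.+1 - u m| <= E * q ^+ m) ->
  forall n m, (n <= m)%N -> `|u m - u n| <= 2 * E * q ^+ n.
Proof.
move=> q0 q2 hu n m le_nm.
have E0 : 0 <= E by have := hu 0%N; rewrite expr0 mulr1; apply: le_trans.
(* Subtracting q^m makes the induction close: a step costs E q^m <= 2 E (q^m - q^(m+1)) because q <=
   1/2. *)
suff : `|u m - u n| <= 2 * E * (q ^+ n - q ^+ m).
  move=> h; apply: le_trans h _; rewrite ler_wpM2l ?mulr_ge0 //.
  by rewrite gerBl exprn_ge0.
rewrite -(subnKC le_nm); elim: (m - n)%N => [|k IH].
  by rewrite addn0 !subrr normr0 mulr0.
rewrite addnS; have -> : u (n + k).+1 - u n =
  (u (n + k).+1 - u (n + k)%N) + (u (n + k)%N - u n) by ring.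
apply: le_trans (ler_normD _ _) _; apply: le_trans (lerD (hu _) IH) _.
rewrite exprS; have : 0 <= E * q ^+ (n + k) by rewrite mulr_ge0 // exprn_ge0.
by move: (q ^+ (n + k)) (q ^+ n) => X Y; nra.
Qed.

Lemma geometric_limit (u : R^nat) (l E q : R) : 0 <= q -> q <= 2^-1 ->
  (forall m, `|u m.+1 - u m| <= E * q ^+ m) ->
  u @ \oo --> l -> forall n, `|l - u n| <= 2 * E * q ^+ n.
Proof.
move=> q0 q2 hu ul n; apply/ler_addgt0Pr => e e0.
have /cvgrPdist_le/(_ e e0)[N _ hN] := ul.
have := hN (maxn N n) (leq_maxl _ _).
have := geometric_steps q0 q2 hu (leq_maxr N n).
move: (u (maxn N n)) => v h1 /= h2.
have -> : l - u n = (v - u n) + (l - v) by ring.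
by apply: le_trans (ler_normD _ _) _; rewrite lerD.
Qed.

Lemma geometric_cvg (u : R^nat) (E q : R) : 0 <= q -> q <= 2^-1 ->
  (forall m, `|u m.+1 - u m| <= E * q ^+ m) -> cvgn u.
Proof.
move=> q0 q2 hu.
have -> : u = (fun n => u 0%N + series (telescope u) n).
  by apply/funext => n; rewrite -eq_sum_telescope.
apply: is_cvgD; first exact: is_cvg_cst.
apply: normed_cvg; apply: (@series_le_cvg _ _ (geometric E q)).
- by move=> n /=.
- by move=> n; rewrite /geometric /= mulr_ge0 ?exprn_ge0 //;
    have := hu 0%N; rewrite expr0 mulr1; apply: le_trans.
- by move=> n; apply: hu.
- by apply: is_cvg_geometric_series; rewrite ger0_norm //; lra.
Qed.

End Approximation.

(** * Approximation of power series and of q-Pochhammer products *)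

Section ApproxInstances.
Local Open Scope classical_set_scope.
Variable R : realType.

(** Convergence at 1/2 bounds c_k 2^(-k), so the term of index k at x is at most a constant times (2
    x)^k. *)
Lemma approx_power_series n (c : R^nat) (f : R -> R) :
  (forall x, 0 < x -> x <= 2^-1 -> series (fun k => c k * x ^+ k) @ \oo --> f x) ->
  approx n f (\poly_(k < n) c k).
Proof.
move=> hf; have h2 : (0 : R) < 2^-1 by rewrite invr_gt0.
have /cvgP/cvg_series_cvg_0/cvgP/cvg_seq_bounded[B [_ hB]] := hf _ h2 (lexx _).
have {}hB k : `|c k * 2^-1 ^+ k| <= B + 1 by apply: (hB (B + 1)) => //; lra.
exists (2 * (B + 1) * 2 ^+ n) => x x0 x4.
have -> : (\poly_(k < n) c k).[x] = series (fun k => c k * x ^+ k) n.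
  by rewrite horner_poly /series /= big_mkord.
rewrite -[leRHS]mulrA -exprMn; apply: geometric_limit; [lra|lra| |by apply: hf => //; lra].
move=> m; rewrite /series /= big_nat_recr //= addrAC subrr add0r.
have -> : c m * x ^+ m = c m * 2^-1 ^+ m * (2 * x) ^+ m.
  by rewrite -mulrA -exprMn mulrA mulVf ?mul1r // pnatr_eq0.
rewrite normrM [`|(2 * x) ^+ m|]ger0_norm ?exprn_ge0 //; last by lra.
by rewrite ler_wpM2r // exprn_ge0 //; lra.
Qed.

(** From |1 - a q^k| <= 1 + 2^(-k) <= exp(2^(-k)), the partial products stay below exp(2) in
    absolute value. *)
Lemma qprod_steps (a q : R) : `|a| <= 1 -> 0 <= q -> q <= 2^-1 ->
  forall m, `|\prod_(0 <= k < m.+1) (1 - a * q ^+ k)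
     - \prod_(0 <= k < m) (1 - a * q ^+ k)| <= expR 2 * q ^+ m.
Proof.
move=> a1 q0 q2 m; have aq k : `|a * q ^+ k| <= 2^-1 ^+ k.
  rewrite normrM -[leRHS]mul1r ler_pM // ger0_norm ?exprn_ge0 //.
  by rewrite lerXn2r // nnegrE.
set P := fun n => \prod_(0 <= k < n) (1 - a * q ^+ k).
(* The exponent is the sum of 2^(-k) over k < n. *)
have hP n : `|P n| <= expR (2 - 2 * 2^-1 ^+ n).
  elim: n => [|n IH].
    by rewrite /P big_nil normr1 expr0 mulr1 subrr expR0.
  rewrite /P big_nat_recr //= normrM.
  have -> : 2 - 2 * 2^-1 ^+ n.+1 = (2 - 2 * 2^-1 ^+ n) + 2^-1 ^+ n :> R.
    by rewrite exprS; lra.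
  rewrite expRD ler_pM //; apply: le_trans (expR_ge1Dx _).
  by apply: le_trans (ler_normB _ _) _; rewrite normr1 lerD2l.
rewrite big_nat_recr //= -/(P m) mulrBr mulr1 addrAC subrr add0r normrN normrM.
rewrite ler_pM //; first by apply: le_trans (hP m) _; rewrite ler_expR gerBl mulr_ge0 ?exprn_ge0.
by rewrite normrM -[leRHS]mul1r ler_pM // ger0_norm ?exprn_ge0.
Qed.

Lemma cvgn_qprod (a q : R) : `|a| <= 1 -> 0 <= q -> q <= 2^-1 ->
  cvgn (fun m => \prod_(0 <= k < m) (1 - a * q ^+ k)).
Proof. by move=> a1 q0 q2; apply: (geometric_cvg q0 q2 (qprod_steps a1 q0 q2)). Qed.

(** The error after n factors is O((x^M)^n), and x^M <= x. *)
Lemma approx_qpoch n (c : R) a M : `|c| <= 1 -> (0 < M)%N ->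
  approx n (fun x => qpoch (- c * x ^+ a) (x ^+ M))
    (\prod_(k < n) (1 + c%:P * 'X^(M * k + a))).
Proof.
move=> c1 M0; exists (2 * expR 2) => x x0 x4.
have x1 : x <= 1 by lra.
have q0 : 0 <= x ^+ M by rewrite exprn_ge0 // ltW.
have qx : x ^+ M <= x by rewrite -[leRHS]expr1 ler_wiXn2l // ltW.
have q2 : x ^+ M <= 2^-1 by lra.
have a1 : `|- c * x ^+ a| <= 1.
  have xa0 : 0 <= x ^+ a by rewrite exprn_ge0 // ltW.
  rewrite normrM normrN -[leRHS]mulr1 ler_pM // ger0_norm //.
  by rewrite exprn_ile1 // ltW.
have -> : (\prod_(k < n) (1 + c%:P * 'X^(M * k + a))).[x] =
    \prod_(0 <= k < n) (1 - (- c * x ^+ a) * (x ^+ M) ^+ k).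
  rewrite big_mkord horner_prod; apply: eq_bigr => k _.
  by rewrite hornerD hornerM !hornerC hornerXn exprD exprM; ring.
apply: le_trans (geometric_limit q0 q2 (qprod_steps a1 q0 q2) (cvgn_qprod a1 q0 q2) n) _.
by rewrite ler_wpM2l ?mulr_ge0 ?expR_ge0 // lerXn2r // nnegrE ltW.
Qed.

End ApproxInstances.

(** * From the unit disc to its real points *)

Lemma unit_disc_expansion_ext (K : numFieldType) c (F G : K -> K) :
  F =1 G -> unit_disc_expansion c F -> unit_disc_expansion c G.
Proof. by move=> /funext ->. Qed.

Lemma qpochs2 (K : numFieldType) (x y q : K) :
  qpochs [:: x; y] q = qpoch x q * qpoch y q.
Proof. by rewrite /qpochs !big_cons big_nil mulr1. Qed.

Lemma qpochs2C (K : numFieldType) (x y q : K) :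
  qpochs [:: x; y] q = qpochs [:: y; x] q.
Proof. by rewrite !qpochs2 mulrC. Qed.

Section RealPoints.
Local Open Scope classical_set_scope.
Variables (R : realType) (K : numFieldType) (phi : {rmorphism R -> K}).
Hypothesis phi_le : {mono phi : x y / x <= y}.
Hypothesis phi_norm : forall x, `|phi x| = phi `|x|.
Hypothesis phi_onto : forall e : K, 0 < e -> exists2 d : R, 0 < d & phi d = e.

Lemma phi_lt : {mono phi : x y / x < y}.
Proof. exact: leW_mono. Qed.

(** Positive elements of [K] come from [R], so an epsilon can be moved either way. *)
Lemma cvg_phi (u : R^nat) (l : R) :
  (fun n => phi (u n)) @ \oo --> phi l <-> u @ \oo --> l.
Proof.
split=> /cvgrPdist_lt h; apply/cvgrPdist_lt => e e0.
  have /h : 0 < phi e by rewrite -(rmorph0 phi) phi_lt.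
  by apply: filterS => n; rewrite -rmorphB phi_norm phi_lt.
have [d d0 <-] := phi_onto e0; have := h d d0.
by apply: filterS => n; rewrite -rmorphB phi_norm phi_lt.
Qed.

Lemma qpoch_phi (a q : R) : `|a| <= 1 -> 0 <= q -> q <= 2^-1 ->
  qpoch (phi a) (phi q) = phi (qpoch a q).
Proof.
move=> a1 q0 q2; apply: cvg_lim; first exact: norm_hausdorff.
have -> : (fun n => \prod_(0 <= k < n) (1 - phi a * phi q ^+ k)) =
   (fun n => phi (\prod_(0 <= k < n) (1 - a * q ^+ k))).
  apply/funext => n; rewrite rmorph_prod; apply: eq_bigr => k _.
  by rewrite rmorphB rmorph1 rmorphM rmorphXn.
by apply/cvg_phi; apply: cvgn_qprod.
Qed.

(** On (0, 1/2] series and product are values of one real function; its two approximations of order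
    N + 1 have the same coefficient at N. *)
Lemma expansion_coef_eq0 (s : R) (a b : nat) (c : nat -> int) :
  s = 1 \/ s = -1 -> (a + b = 5)%N -> (0 < a)%N -> (0 < b)%N ->
  unit_disc_expansion c (fun q : K =>
    qpochs [:: - phi s * q ^+ a; - phi s * q ^+ b] (q ^+ 5)
    * qpochs [:: phi s * q ^+ (b + 5); phi s * q ^+ a] (q ^+ 10) ^+ 3) ->
  forall N, N = 2 * a %[mod 5] -> c N = 0.
Proof.
move=> s1 ab a0 b0 hc N N5.
have ns : `|s| = 1 by case: s1 => ->; rewrite ?normrN normr1.
(* The form - (- s) fits [approx_qpoch] with c = - s. *)
pose f (x : R) :=
  (qpoch (- s * x ^+ a) (x ^+ 5) * qpoch (- s * x ^+ b) (x ^+ 5))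
    * (qpoch (- (- s) * x ^+ (b + 5)) (x ^+ 10)
       * qpoch (- (- s) * x ^+ a) (x ^+ 10)) ^+ 3.
have hf x : 0 < x -> x <= 2^-1 -> series (fun k => (c k)%:~R * x ^+ k) @ \oo --> f x.
  move=> x0 x2; apply/cvg_phi.
  have phix : `|phi x| < 1.
    by rewrite phi_norm -(rmorph1 phi) phi_lt gtr0_norm //; lra.
  have qphi t i M : `|t| <= 1 -> (0 < M)%N ->
      qpoch (phi t * phi x ^+ i) (phi x ^+ M) = phi (qpoch (t * x ^+ i) (x ^+ M)).
    move=> t1 M0; have x1 : x <= 1 by lra.
    have xi0 j : 0 <= x ^+ j by rewrite exprn_ge0 // ltW.
    rewrite -qpoch_phi ?rmorphM ?rmorphXn //.
      rewrite normrM -[leRHS]mulr1 ler_pM // ger0_norm //.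
      by rewrite exprn_ile1 // ltW.
    by apply: le_trans x2; rewrite -[leRHS]expr1 ler_wiXn2l // ltW.
  have -> : phi (f x) =
    qpochs [:: - phi s * phi x ^+ a; - phi s * phi x ^+ b] (phi x ^+ 5)
    * qpochs [:: phi s * phi x ^+ (b + 5); phi s * phi x ^+ a] (phi x ^+ 10) ^+ 3.
    rewrite !qpochs2 -rmorphN !qphi ?normrN ?ns // /f !opprK.
    by rewrite rmorphM [phi (_ ^+ 3)]rmorphXn !rmorphM.
  rewrite (_ : (fun n => _) = series (fun k => (c k)%:~R * phi x ^+ k)).
    exact: hc.
  apply/funext => n; rewrite /series /= rmorph_sum; apply: eq_bigr => k _.
  by rewrite rmorphM rmorph_int rmorphXn.
have h1 := approx_power_series N.+1 hf.
have h2 : approx N.+1 f (triple_prod s%:P a b N.+1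
    * triple_prod (- s)%:P (b + 5) a N.+1 ^+ 3).
  have ba : (b + 5 + a = 10)%N by lia.
  have n1 : `|s| <= 1 by rewrite ns.
  have n2 : `|- s| <= 1 by rewrite normrN.
  rewrite /triple_prod ba ab.
  by do ?[apply: approxM | apply: approxX]; apply: approx_qpoch.
have := approx_coef h1 h2 (ltnSn N).
rewrite coef_poly ltnSn prod_coef_eq0 // => /eqP.
by rewrite intr_eq0 => /eqP.
Qed.

End RealPoints.

Local Open Scope complex_scope.

Theorem theorem10 (R : realType) (eps : R[i]) (e f : nat -> int)
  (heps : eps = 1 \/ eps = -1)
  (he : unit_disc_expansion e (fun q : R[i] =>
          qpochs [:: - eps * q; - eps * q ^+ 4] (q ^+ 5)
          * qpochs [:: eps * q ^+ 4; eps * q ^+ 6] (q ^+ 10) ^+ 3))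
  (hf : unit_disc_expansion f (fun q : R[i] =>
          qpochs [:: - eps * q ^+ 2; - eps * q ^+ 3] (q ^+ 5)
          * qpochs [:: eps * q ^+ 2; eps * q ^+ 8] (q ^+ 10) ^+ 3)) :
  forall n : nat, e (5 * n + 3)%N = 0 /\ f (5 * n + 4)%N = 0.
Proof.
pose phi : {rmorphism R -> R[i]} := real_complex R.
have phi_le : {mono phi : x y / x <= y} by move=> x y; rewrite lecR.
have phi_norm x : `|phi x| = phi `|x| by rewrite normc_def /= expr0n addr0 sqrtr_sqr.
have phi_onto (z : R[i]) : 0 < z -> exists2 d : R, 0 < d & phi d = z.
  by case: z => x y; rewrite ltcE /= => /andP[/eqP -> x0]; exists x.
have [s s1 Es] : exists2 s : R, s = 1 \/ s = -1 & eps = phi s.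
  case: heps => ->; first by exists 1; [left | rewrite rmorph1].
  by exists (-1); [right | rewrite rmorphN1].
have vanishing a b c := @expansion_coef_eq0 _ _ _ phi_le phi_norm phi_onto s a b c s1.
move=> n; rewrite Es in he hf; split.
  (* For a = 4, 2 a = 8 is 3 modulo 5; below, a = 2 gives 4. *)
  refine (vanishing 4%N 1%N _ erefl isT isT _ _ _); last by clear; lia.
  apply: unit_disc_expansion_ext he => q.
  by rewrite (qpochs2C (- phi s * q)) (qpochs2C (phi s * q ^+ 4)).
refine (vanishing 2%N 3%N _ erefl isT isT _ _ _); last by clear; lia.
apply: unit_disc_expansion_ext hf => q.
by rewrite (qpochs2C (phi s * q ^+ 2)).
Qed.
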